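(* Let $K$ be a field, let $m,n$ be positive relatively prime integers, and endow $\mathbb Z\oplus\mathbb Z$ with the lexicographic order. Let $w=y^m+x^n$, $\alpha=(-1,-1)$, $\beta=(0,-1)$, and let $v$ be the map associated to $(m,n,w,\alpha,\beta)$. Then $v$ is a $K$-valuation on $K(x,y)$; one has $v(K[x,y]^* )\subseteq\mathbb Z_{\ge0}\alpha+\mathbb Z_{\ge0}\beta\subset\mathbb Z_{\le0}\oplus\mathbb Z_{\le0}$, and $v(K[x,y]^* )$ is reversely well-ordered. However, $(-1,0)\notin\mathbb Z_{\ge0}\alpha+\mathbb Z_{\ge0}\beta$, so $v(K[x,y]^* )\ne\mathbb Z_{\le0}\oplus\mathbb Z_{\le0}$, and $v$ does not come from a monomial order in suitable variables.
   Context: $S^*$ denotes the nonzero elements of $S$. Lexicographic order on $\mathbb Z\oplus\mathbb Z$: $(a,b)$ is positive iff $a>0$, or $a=0$ and $b>0$. A partially ordered set is reversely well-ordered if every nonempty subset has a largest element. $K$-valuation: given a field extension $L\mid K$ and a totally ordered abelian group $\Gamma$, a $K$-valuation on $L$ is a map $v:L\to\Gamma\cup\{\infty\}$ such that for all $f,g\in L$: (i) $v(f)=\infty$ iff $f=0$; (ii) $v(fg)=v(f)+v(g)$; (iii) $v(f+g)\ge\min\{v(f),v(g)\}$; (iv) if $v(f)=v(g)\ne\infty$, then there is a unique $\lambda\in K$ with $v(f+\lambda g)>v(f)$. $v_\infty:K(x)\to\mathbb Z\cup\{\infty\}$ is the degree valuation: $v_\infty(0)=\infty$ and $v_\infty(f/g)=\deg_x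 g-\deg_x f$ for $f,g\in K[x]^*$. $w$-expansion: if $w\in K(x)[y]$ has $\deg_y w=m\ge 1$, every $f\in K(x)[y]$ can be written as $f=\sum_{i=0}^{\ell}\sum_{j=0}^{m-1}f_{i,j}y^jw^i$ with $f_{i,j}\in K(x)$, uniquely up to adding zero coefficients. Map associated to $(m,n,w,\alpha,\beta)$, where $w\in K(x)[y]$ is monic in $y$ of $y$-degree $m$, and $\alpha<0$ and $\beta$ are nonzero elements of $\mathbb Z\oplus\mathbb Z$ that are indivisible (not of the form $k\gamma$ with $k\ge2$ an integer and $\gamma\in\mathbb Z\oplus\mathbb Z$) and not commensurable (no nonzero integer multiples of them coincide): the map $v:K(x)[y]\to(\mathbb Z\oplus\mathbb Z)\cup\{\infty\}$ with $v(0)=\infty$ and, for $f\ne0$ with $w$-expansion $f=\sum_{i=0}^{\ell}\sum_{j=0}^{m-1}f_{i,j}y^jw^i$, $v(f)=\min_{0\le i\le\ell,\,0\le j\le m-1}\{-v_\infty(f_{i,j})m\alpha+jn\alpha+i\beta\}$, where zero coefficients contribute $\infty$. It is regarded as a map on $K(x,y)$ via $v(f/g)=v(f)-v(g)$. A valuation $v$ on $K(x_1,\dots,x_r)$ with values in $\mathbb Z^r\cup\{\infty\}$ comes from a monomial order in suitable variables if, for every nonzero polynomial $f\in K[x_1,\dots,x_r]$, $v(f)=-\exp(\mathrm{lm}(\varphi(f)))$, where $\varphi$ is a fixed $K$-algebra automorphism of $K[x_1,\dots,x_r]$, $\mathrm{lm}(h)$ is the leading monomial of $h$ with respect to a fixed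 monomial order, and $\exp$ is the exponent vector of a monomial. *)

(* Defs.v *)
From HB Require Import structures.
From mathcomp Require Import all_boot all_order all_algebra.
From mathcomp Require Import mpoly zify.

Set Implicit Arguments.
Unset Strict Implicit.
Unset Printing Implicit Defensive.

Import Order.TTheory GRing.Theory Num.Theory.
Local Open Scope ring_scope.

(* [porderZmodType] does not require the order to be compatible with the
   addition. *)
Record orderedGroup := OrderedGroup {
  og_sort :> zmodType;
  og_le : rel og_sort;
  og_le_anti : antisymmetric og_le;
  og_le_trans : transitive og_le;
  og_le_total : total og_le;
  og_leD2r : forall c a b, og_le a b -> og_le (a + c) (b + c)
}.

Definition og_lt (G : orderedGroup) (a b : G) : bool := ~~ og_le b a.

Definition lexZZ : rel (int * int) :=
  fun a b => ((a : int *l int) <= (b : int *l int))%O.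

Lemma lexZZ_leE a b :
  lexZZ a b = (a.1 < b.1) || (a.1 == b.1) && (a.2 <= b.2).
Proof.
change ((a.1 <= b.1) && ((b.1 <= a.1) ==> (a.2 <= b.2)) =
  (a.1 < b.1) || (a.1 == b.1) && (a.2 <= b.2)).
by case: ltgtP.
Qed.

Lemma lexZZ_anti : antisymmetric lexZZ.
Proof. by move=> a b; apply: (@le_anti _ (int *l int)). Qed.

Lemma lexZZ_trans : transitive lexZZ.
Proof. by move=> b a c; apply: (@le_trans _ (int *l int)). Qed.

Lemma lexZZ_total : total lexZZ.
Proof. by move=> a b; apply: (@le_total _ (int *l int)). Qed.

Lemma lexZZ_leD2r (c a b : int * int) : lexZZ a b -> lexZZ (a + c) (b + c).
Proof. by rewrite !lexZZ_leE /= ltrD2r lerD2r (inj_eq (addIr _)). Qed.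

Definition ZZ : orderedGroup :=
  OrderedGroup lexZZ_anti lexZZ_trans lexZZ_total lexZZ_leD2r.

Lemma ZZ_gt0 (a : ZZ) :
  og_lt 0 a = (0 < a.1) || (a.1 == 0) && (0 < a.2).
Proof.
rewrite /og_lt [og_le _ _]lexZZ_leE /= negb_or negb_and.
by case: (ltgtP a.1 0); case: (ltgtP a.2 0).
Qed.

(* The set G u {oo} is [option G], with [None] the element oo. *)
Section Infinity.
Variable G : orderedGroup.
Implicit Types a b : option G.

Definition oadd a b : option G :=
  if (a, b) is (Some x, Some y) then Some (x + y) else None.

Definition ole a b : bool :=
  match a, b with
  | _, None => true
  | None, Some _ => false
  | Some x, Some y => og_le x y
  end.

Definition olt a b : bool := ~~ ole b a.

Definition omin a b : option G := if ole a b then a else b.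

Lemma ole_refl : reflexive ole.
Proof. by case=> [x|] //=; rewrite -[og_le x x]orbb og_le_total. Qed.

Lemma ole_trans : transitive ole.
Proof. by move=> [y|] [x|] [z|] //=; apply: og_le_trans. Qed.

Lemma ole_anti : antisymmetric ole.
Proof. by move=> [y|] [x|] //= /og_le_anti ->. Qed.

Lemma ole_total : total ole.
Proof. by move=> [y|] [x|] //=; apply: og_le_total. Qed.

Lemma ominA : associative omin.
Proof.
move=> a b c; rewrite /omin.
case bc: (ole b c); case ab: (ole a b) => //.
- by rewrite (ole_trans ab bc).
- by rewrite bc.
rewrite bc; case ac: (ole a c) => //.
have /orP[cb|] := ole_total c b; last by rewrite bc.
have /orP[ba|] := ole_total b a; last by rewrite ab.
by apply: ole_anti; rewrite ac (ole_trans cb ba).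
Qed.

Lemma omin0l : left_id None omin.
Proof. by case. Qed.

Lemma omin0r : right_id None omin.
Proof. by case. Qed.

HB.instance Definition _ :=
  Monoid.isLaw.Build (option G) None omin ominA omin0l omin0r.
End Infinity.

(* gamma - oo is a junk value. *)
Definition osub (G : zmodType) (a b : option G) : option G :=
  if (a, b) is (Some x, Some y) then Some (x - y) else None.

(* K-valuations on L, where the extension L | K is given by iota : K -> L. *)
Record is_Kvaluation (K L : fieldType) (iota : {rmorphism K -> L})
    (G : orderedGroup) (v : L -> option G) : Prop := {
  Kval_oo : forall f, v f = None <-> f = 0;
  Kval_mul : forall f g, v (f * g) = oadd (v f) (v g);
  Kval_add : forall f g, ole (omin (v f) (v g)) (v (f + g));
  Kval_res : forall f g, v f = v g -> v f <> None ->
    exists! lam : K, olt (v f) (v (f + iota lam * g))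
}.

Notation "x %:F" := (@FracField.tofrac _ x) : ring_scope.

(* The map f / g |-> v f - v g on the fraction field of R, evaluated on the
   numerator and denominator of the chosen representative of u; it does not
   depend on this choice as soon as v (f * g) = v f + v g. *)
Definition frac_map (R : idomainType) (G : zmodType) (v : R -> option G)
    (u : {fraction R}) : option G :=
  osub (v \n_(repr u)) (v \d_(repr u)).

Lemma frac_repr (R : idomainType) (u : {fraction R}) :
  u = (\n_(repr u))%:F / (\d_(repr u))%:F.
Proof.
have d0 := denom_ratioP (repr u).
apply: (canRL (mulfK _)); first by rewrite tofrac_eq0.
set r := repr u; rewrite -[u]reprK -/r -[_ * _]/(FracField.mul _ _).
rewrite !piE; apply/eqmodP.
rewrite /= FracField.equivfE /FracField.mulf !numden_Ratio ?mulr1 ?oner_eq0 //.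
by rewrite mulrC.
Qed.

Lemma frac_mapE (R : idomainType) (G : zmodType) (v : R -> option G) :
    v 0 = None -> (forall f, f != 0 -> v f != None) ->
    (forall f g a b, v f = Some a -> v g = Some b -> v (f * g) = Some (a + b)) ->
  forall f g, g != 0 -> frac_map v (f%:F / g%:F) = osub (v f) (v g).
Proof.
move=> v0 vN vM f g g0; rewrite /frac_map.
set u := f%:F / g%:F; set n := \n_(repr u); set e := \d_(repr u).
have e0 : e != 0 := denom_ratioP _.
have E : f * e = n * g.
  have /eqP := frac_repr u; rewrite /u -/u -/n -/e eqr_div ?tofrac_eq0 //.
  by rewrite -!tofracM tofrac_eq => /eqP.
have [f0|f0] := eqVneq f 0.
  move: E; rewrite f0 mul0r => /esym/eqP; rewrite mulf_eq0 (negPf g0) orbF.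
  by move/eqP->; rewrite v0.
have n0 : n != 0.
  apply/eqP => n0; move/eqP: E.
  by rewrite n0 mul0r mulf_eq0 (negPf f0) (negPf e0).
case Ef: (v f) (vN f f0) => [a|] // _; case Eg: (v g) (vN g g0) => [b|] // _.
case En: (v n) (vN n n0) => [c|] // _; case Ee: (v e) (vN e e0) => [h|] // _.
have := vM _ _ _ _ Ef Ee; rewrite E (vM _ _ _ _ En Eg) => -[H] /=.
congr Some; apply/eqP; rewrite subr_eq addrAC eq_sym subr_eq; apply/eqP.
by rewrite -H.
Qed.

Definition Kx (K : fieldType) : fieldType := {fraction {poly K}}.
Definition Kx_y (K : fieldType) : idomainType := {poly Kx K}.
Definition Kxy (K : fieldType) : fieldType := {fraction Kx_y K}.

Definition v_infty (K : fieldType) : Kx K -> option int :=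
  frac_map (fun f : {poly K} =>
    if f == 0 then None else Some (- ((size f).-1)%:Z)).

Lemma v_inftyE (K : fieldType) (f g : {poly K}) : g != 0 ->
  v_infty (f%:F / g%:F : Kx K) =
    if f == 0 then None else Some ((size g).-1%:Z - (size f).-1%:Z).
Proof.
move=> g0; rewrite /v_infty frac_mapE // ?eqxx //.
- rewrite (negPf g0); case: eqP => //= _.
  by congr Some; rewrite opprK addrC.
- by move=> h /negPf ->.
move=> {g0}{}f {}g a b; case: (eqVneq f 0) => // f0 [<-].
case: (eqVneq g 0) => // g0 [<-].
rewrite mulf_eq0 (negPf f0) (negPf g0) /= size_mul //.
rewrite -!size_poly_gt0 in f0 g0.
case: (size f) f0 (size g) g0 => [|p] // _ [|q] // _.
by rewrite addSn addnS /= PoszD opprD.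
Qed.

Lemma v_infty0 (K : fieldType) : v_infty (0 : Kx K) = None.
Proof.
by rewrite -[0](mul0r (1%:F)^-1) -tofrac0 v_inftyE ?oner_eq0 ?eqxx.
Qed.

Section Expansion.
Variable F : fieldType.
Implicit Types (w f : {poly F}) (c : nat -> nat -> F).

(* f = \sum_(0 <= i <= l) \sum_(0 <= j < m) f_ij y^j w^i. *)
Definition is_w_expansion m w f l c : Prop :=
  f = \sum_(i < l.+1) \sum_(j < m) (c i j)%:P * 'X^j * w ^+ i.

(* The coefficients of the expansion in base w, by Euclidean division. *)
Definition w_coef w f (i j : nat) : F := ((f %/ w ^+ i) %% w)`_j.

Variables (m : nat) (w : {poly F}).
Hypotheses (m_gt0 : (0 < m)%N) (w_monic : w \is monic) (size_w : size w = m.+1).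

Let w_neq0 : w != 0. Proof. exact: monic_neq0. Qed.

Let digit c i : {poly F} := \poly_(j < m) c i j.

Let digitE c i : \sum_(j < m) (c i j)%:P * 'X^j * w ^+ i = digit c i * w ^+ i.
Proof.
rewrite /digit poly_def mulr_suml; apply: eq_bigr => j _.
by rewrite mul_polyC.
Qed.

Lemma w_coefP f : is_w_expansion m w f (size f) (w_coef w f).
Proof.
rewrite /is_w_expansion; under eq_bigr do rewrite digitE.
have dE i : digit (w_coef w f) i = (f %/ w ^+ i) %% w.
  apply/polyP => j; rewrite coef_poly; case: ltnP => // mj.
  rewrite nth_default // (leq_trans _ mj) // -ltnS -size_w.
  by rewrite ltn_modp.
under eq_bigr do rewrite dE.
have step N :
  f = \sum_(i < N) (f %/ w ^+ i) %% w * w ^+ i + f %/ w ^+ N * w ^+ N.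
  elim: N => [|N IH]; first by rewrite big_ord0 add0r expr0 divp1 mulr1.
  rewrite {1}IH big_ord_recr /= -addrA; congr (_ + _).
  have -> : f %/ w ^+ N.+1 = f %/ w ^+ N %/ w by rewrite exprSr divp_divl.
  rewrite {1}(divp_eq (f %/ w ^+ N) w).
  by rewrite mulrDl -mulrA -exprS addrC.
rewrite {1}(step (size f).+1) divp_small ?mul0r ?addr0 //.
have := size_exp w (size f).+1; rewrite size_w /= => E.
apply: leq_trans (leq_pred _); rewrite E.
by rewrite leq_pmull.
Qed.

Lemma w_expansion_unique f l c : is_w_expansion m w f l c ->
  forall i j, (j < m)%N -> w_coef w f i j = if (i <= l)%N then c i j else 0.
Proof.
rewrite /is_w_expansion; under eq_bigr do rewrite digitE.
move=> fE i j jm.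
pose c' k h : F := if (k <= l)%N then c k h else 0.
have {}fE N : (l < N)%N -> f = \sum_(k < N) digit c' k * w ^+ k.
  move=> lN; rewrite fE (big_ord_widen _ (fun k => digit c k * w ^+ k) lN).
  rewrite big_mkcond; apply: eq_bigr => k _ /=; rewrite ltnS /digit /c'.
  case: leqP => // _; rewrite (_ : \poly_(_ < _) _ = 0) ?mul0r //.
  by apply/polyP => h; rewrite coef_poly coef0 if_same.
have dig_small k : (size (digit c' k) < size w)%N.
  by rewrite size_w ltnS size_poly.
have low M : (size (\sum_(k < M) digit c' k * w ^+ k)%R
    < size (w ^+ M)%R)%N.
  elim: M => [|M IH]; first by rewrite big_ord0 expr0 size_poly0 size_poly1.
  rewrite big_ord_recr /=; apply: leq_ltn_trans (size_polyD _ _) _.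
  rewrite gtn_max (leq_trans IH) /=; last first.
    by rewrite exprS size_monicM ?expf_neq0 // size_w addSn leq_addl.
  have [->|d0] := eqVneq (digit c' M) 0.
    by rewrite mul0r size_poly0 size_poly_gt0 expf_neq0.
  have wX N : w ^+ N \is monic by rewrite monic_exp.
  rewrite (size_Mmonic d0) // exprS size_Mmonic //.
  have := dig_small M; have : (0 < size (w ^+ M)%R)%N.
    by rewrite size_poly_gt0 expf_neq0.
  by lia.
have divE : f %/ w ^+ i =
    \sum_(k < l.+1) digit c' (i + k) * w ^+ k.
  have lN : (l < i + l.+1)%N by lia.
  rewrite {1}(fE _ lN) big_split_ord /=.
  under [X in _ + X]eq_bigr do rewrite exprD mulrCA.
  by rewrite -mulr_sumr addrC [_ * \sum_(_ < _) _]mulrC divp_addl_mul_small ?low.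
rewrite /w_coef divE big_ord_recl expr0 mulr1 addn0.
under eq_bigr do rewrite /= exprSr mulrA.
rewrite -mulr_suml addrC modp_addl_mul_small ?dig_small //.
by rewrite coef_poly jm.
Qed.

End Expansion.

Section AssociatedMap.
Variable K : fieldType.
Implicit Types (w f : Kx_y K) (c : nat -> nat -> Kx K) (a b : ZZ).

(* -v_infty(f_ij) m alpha + j n alpha + i beta *)
Definition w_term m n a b (i j : nat) (u : Kx K) : option ZZ :=
  omap (fun k : int => a *~ (- k * m%:Z) + a *+ (j * n) + b *+ i) (v_infty u).

Definition w_min m n a b l c : option ZZ :=
  \big[@omin ZZ/None]_(i < l.+1) \big[@omin ZZ/None]_(j < m)
    w_term m n a b i j (c i j).

(* The map associated to (m, n, w, alpha, beta), on K(x)[y]; by [assoc_mapE]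
   below any w-expansion of f may be used in place of this one. *)
Definition assoc_map m n w a b f : option ZZ :=
  w_min m n a b (size f) (w_coef w f).

(* The same map on K(x,y), with v (f / g) = v f - v g. *)
Definition assoc_map_frac m n w a b : Kxy K -> option ZZ :=
  frac_map (assoc_map m n w a b).

Definition indivisible a : Prop :=
  forall (k : nat) (g : ZZ), (2 <= k)%N -> a <> g *+ k.

Definition commensurable a b : Prop :=
  exists k l : int, [/\ k != 0, l != 0 & a *~ k = b *~ l].

(* The standing hypotheses on (m, w, alpha, beta). *)
Definition admissible m w a b : Prop :=
  [/\ w \is monic, size w = m.+1, og_lt a (0 : ZZ), b != 0 &
      [/\ indivisible a, indivisible b & ~ commensurable a b]].

Lemma assoc_mapE m n w a b f l c :
    (0 < m)%N -> w \is monic -> size w = m.+1 ->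
  is_w_expansion m w f l c ->
  assoc_map m n w a b f = w_min m n a b l c.
Proof.
move=> m0 wM wS fE; have cE := w_expansion_unique m0 wM wS fE.
have c0 := w_expansion_unique m0 wM wS (w_coefP m0 wM wS f).
have wt0 i j : w_term m n a b i j 0 = None by rewrite /w_term v_infty0.
pose T i : option ZZ := \big[@omin ZZ/None]_(j < m)
  w_term m n a b i j (w_coef w f i j).
have widen L N : (forall i, (L <= i)%N -> T i = None) -> (L <= N)%N ->
    \big[@omin ZZ/None]_(i < N) T i = \big[@omin ZZ/None]_(i < L) T i.
  move=> T0 LN; rewrite -(subnKC LN) big_split_ord /=.
  have -> : \big[@omin ZZ/None]_(i < N - L) T (L + i)%N = None.
    by apply: big1 => i _; rewrite T0 ?leq_addr.
  by rewrite omin0r.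
rewrite /assoc_map /w_min -/(T _).
transitivity (\big[@omin ZZ/None]_(i < maxn (size f).+1 l.+1) T i).
  apply/esym/widen; last exact: leq_maxl.
  by move=> i si; apply: big1 => j _; rewrite c0 // ifN ?wt0 // -ltnNge.
apply: etrans (widen l.+1 _ _ (leq_maxr _ _)) _.
  by move=> i li; apply: big1 => j _; rewrite cE // ifN ?wt0 // -ltnNge.
apply: eq_bigr => i _; apply: eq_bigr => j _.
by rewrite cE // -ltnS ltn_ord.
Qed.

End AssociatedMap.

Section Example.
Variable K : fieldType.

Lemma admissible_ex m n : (0 < m)%N ->
  admissible m ('X^m + ('X^n : {poly K})%:F%:P : Kx_y K) (-1, -1) (0, -1).
Proof.
move=> m0; set u := ('X^n : {poly K})%:F.
have su : (size (u%:P : Kx_y K) < size ('X^m : Kx_y K))%N.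
  by rewrite size_polyXn ltnS (leq_trans (size_polyC_leq1 _)).
split=> //.
- by rewrite monicE lead_coefDl // lead_coefXn.
- by rewrite size_polyDl // size_polyXn.
have ind1 (z : int) k : (2 <= k)%N -> - 1 <> z *+ k.
  move=> k2 /(congr1 absz); rewrite -mulr_natr natz abszM /= => E.
  by have := dvdn_mull `|z| (dvdnn k); rewrite -E dvdn1; case: k k2 {E} => [|[]].
split=> [k g k2 E|k g k2 E|[k [l [k0 l0 E]]]].
- by apply: (ind1 g.1 k k2); rewrite -(raddfMn fst) -E.
- by apply: (ind1 g.2 k k2); rewrite -(raddfMn snd) -E.
- have := congr1 fst E; rewrite !(raddfMz fst) /= mul0rz => /eqP.
  by rewrite mulNrz intz oppr_eq0 (negPf k0).
Qed.

Definition Kxy_const : {rmorphism K -> Kxy K} :=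
  (@FracField.tofrac (Kx_y K) \o @polyC (Kx K) \o
   @FracField.tofrac {poly K} \o @polyC K).

(* The embedding of K[x,y] into K(x,y); the variables 'X_0 and 'X_1 of
   {mpoly K[2]} are x and y. *)
Definition Kxy_of_mpoly : {mpoly K[2]} -> Kxy K :=
  mmap Kxy_const (fun i : 'I_2 =>
    if i == 0 then (('X : {poly K})%:F%:P : Kx_y K)%:F else ('X : Kx_y K)%:F).

Definition value_set (v : Kxy K -> option ZZ) (g : ZZ) : Prop :=
  exists2 f : {mpoly K[2]}, f != 0 & v (Kxy_of_mpoly f) = Some g.
End Example.

Definition cone (a b g : ZZ) : Prop := exists i j : nat, g = a *+ i + b *+ j.

Definition nonpos_quadrant (g : ZZ) : Prop := g.1 <= 0 /\ g.2 <= 0.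

Definition reversely_well_ordered (G : orderedGroup) (P : G -> Prop) : Prop :=
  forall S : G -> Prop, (forall g, S g -> P g) -> (exists g, S g) ->
  exists2 g, S g & forall h, S h -> og_le h g.

Section MonomialOrder.
Variables (K : fieldType) (r : nat).
Implicit Types (le : rel 'X_{1..r}) (p q s : 'X_{1..r}).

Record monomial_order le : Prop := {
  mo_anti : antisymmetric le;
  mo_trans : transitive le;
  mo_total : total le;
  mo_mul : forall s p q, le p q -> le (p + s)%MM (q + s)%MM;
  mo_wf : forall S : 'X_{1..r} -> Prop, (exists p, S p) ->
    exists2 p, S p & forall q, S q -> le p q
}.

Definition is_lm le (h : {mpoly K[r]}) p : Prop :=
  p \in msupp h /\ forall q, q \in msupp h -> le q p.

(* Only the values of v on polynomials are relevant, so v is a map on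
   K[x_1, ..., x_r]. *)
Definition comes_from_monomial_order
    (v : {mpoly K[r]} -> option 'rV[int]_r) : Prop :=
  exists2 phi : {lrmorphism {mpoly K[r]} -> {mpoly K[r]}}, bijective phi &
  exists2 le, monomial_order le &
  forall f, f != 0 -> exists2 p, is_lm le (phi f) p &
    v f = Some (- \row_i (p i)%:Z).
End MonomialOrder.

Definition rV_of_ZZ (g : ZZ) : 'rV[int]_2 := \row_i (if i == 0 then g.1 else g.2).

(* Main.v *)
Require Import Defs.
From mathcomp Require Import all_boot all_order all_algebra.
From mathcomp Require Import mpoly zify ring.
From Stdlib Require Import Classical_Prop.

Set Implicit Arguments.
Unset Strict Implicit.
Unset Printing Implicit Defensive.

Import Order.TTheory GRing.Theory Num.Theory.
Local Open Scope ring_scope.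

(** Write every nonzero [f] in K(x)[y] as a finite sum of monomials
    [c y^j w^i] with [j < m], whose values are [(deg c * m + j * n) alpha +
    i beta]. Since alpha and beta are not commensurable and [n] is invertible
    modulo [m], distinct monomials of one expansion have distinct finite
    values, so that exactly one monomial dominates [f] ([expansion_dominant]).

    Consequently, if multiplication by [s] shifts the values of all monomials
    by the same [sigma], it shifts all values by [sigma] ([multiplier_mono]).
    This holds for nonzero elements of K(x) and for [w], and also for [y],
    where the only case with something to check is [y * y^(m-1) = w - x^n]: as
    [m n alpha < beta], the term in [x^n] dominates and has the required value
    ([multiplier_y]). Hence it holds for products of these, that is for all
    nonzero monomials, and then, exchanging the two factors, for all nonzero
    elements ([assocM]). The residue condition reduces to dominant monomials:
    equal values force equal [i], [j] and degree of [c], and the leading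
    coefficients in [x] can be cancelled ([assoc_Kvaluation]). Both the degree
    valuation and the final valuation pass from a domain to its fractions by
    [frac_Kvaluation].

    As [w] is monic in [y] over K[x], the expansion of a polynomial has
    polynomial coefficients, whose degrees are nonnegative; its terms, one of
    which is the value, therefore lie in the cone of alpha and beta
    ([cone_assoc]). The cone lies in the nonpositive quadrant, which is
    reversely well-ordered, and omits [(-1, 0)]. A valuation from a monomial
    order would take the value [(-1, 0)], namely at the preimage of [x] under
    the automorphism ([monomial_order_value]). *)

(** * Ordered groups with infinity *)

Section OptionOrder.
Variable G : orderedGroup.
Implicit Types (x y z : option G) (a b c : G).

Lemma ole_Some a b : ole (Some a) (Some b) = og_le a b.
Proof. by []. Qed.

Lemma oaddA : associative (@oadd G).
Proof. by move=> [a|] [b|] [c|] //=; rewrite /oadd addrA. Qed.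

Lemma oadd0 x : oadd (Some 0) x = x.
Proof. by case: x => [a|] //=; rewrite /oadd add0r. Qed.

Lemma osubE a x : osub x (Some a) = oadd (Some (- a)) x.
Proof. by case: x => [b|] //=; rewrite /oadd /osub addrC. Qed.

Lemma oadd_inj a : injective (oadd (Some a)).
Proof. by move=> [b|] [c|] //= [/addrI ->]. Qed.

Lemma og_leD2l a b c : og_le (a + b) (a + c) = og_le b c.
Proof.
apply/idP/idP => [/(og_leD2r (- a))|/(og_leD2r a)].
  by rewrite ![a + _]addrC !addrK.
by rewrite ![_ + a]addrC.
Qed.

Lemma ole_add2l a x y : ole (oadd (Some a) x) (oadd (Some a) y) = ole x y.
Proof. by case: x y => [b|] [c|] //=; rewrite og_leD2l. Qed.

Lemma olt_add2l a x y : olt (oadd (Some a) x) (oadd (Some a) y) = olt x y.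
Proof. by rewrite /olt ole_add2l. Qed.

Lemma oltW x y : olt x y -> ole x y.
Proof. by rewrite /olt; case/orP: (ole_total x y) => ->. Qed.

Lemma olt_le_trans y x z : olt x y -> ole y z -> olt x z.
Proof. by move=> xy yz; apply: contra xy; apply: ole_trans. Qed.

Lemma ole_eqVlt x y : ole x y -> x = y \/ olt x y.
Proof.
move=> xy; case yx: (ole y x); last by right; rewrite /olt yx.
by left; apply: ole_anti; rewrite xy yx.
Qed.

(** Values are compared through their lower bounds, since the lower bounds of
    a minimum are the common lower bounds of its terms. *)
Lemma ole_inj x y : (forall z, ole z x = ole z y) -> x = y.
Proof. by move=> E; apply: ole_anti; rewrite -E ole_refl E ole_refl. Qed.

Lemma ole_omin x y z : ole x (omin y z) = ole x y && ole x z.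
Proof.
rewrite /omin; case yz: (ole y z).
  by case xy: (ole x y) => //=; rewrite (ole_trans xy yz).
have /orP[|zy] := ole_total y z; first by rewrite yz.
by case xz: (ole x z); rewrite ?andbF // (ole_trans xz zy).
Qed.

Lemma ole_bigmin (I : finType) x (F : I -> option G) :
  ole x (\big[@omin G/None]_i F i) = [forall i, ole x (F i)].
Proof.
have xN : ole x None = true by case: x.
by rewrite (big_morph (ole x) (ole_omin x) xN) big_andE.
Qed.

Lemma bigmin_ord x N (F : nat -> option G) :
  ole x (\big[@omin G/None]_(i < N) F i) <->
  forall i, (i < N)%N -> ole x (F i).
Proof.
rewrite ole_bigmin; split=> [/forallP H i iN|H].
  exact: (H (Ordinal iN)).
by apply/forallP => i; apply: H.
Qed.

Lemma omin_or (P : option G -> Prop) x y : P x -> P y -> P (omin x y).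
Proof. by rewrite /omin; case: ifP. Qed.

Lemma og_le_refl a : og_le a a.
Proof. by rewrite -[og_le a a]orbb og_le_total. Qed.

Lemma og_add_ge0 a b : og_le 0 a -> og_le 0 b -> og_le 0 (a + b).
Proof.
by move=> a0 b0; apply: og_le_trans a0 _; rewrite -{1}[a]addr0 og_leD2l.
Qed.

Lemma og_mulrn_ge0 a n : og_le 0 a -> og_le 0 (a *+ n).
Proof.
move=> a0; elim: n => [|n IH]; first by rewrite mulr0n og_le_refl.
by rewrite mulrS og_add_ge0.
Qed.

Lemma og_le_opp a b : og_le (- a) (- b) = og_le b a.
Proof.
by rewrite -(og_leD2l a) subrr -(og_leD2l b) addr0 addrCA subrr addr0.
Qed.

Lemma og_ltW a b : og_lt a b -> og_le a b.
Proof. by rewrite /og_lt; case/orP: (og_le_total a b) => ->. Qed.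

Lemma og_mulrn_gt0 a n : og_lt 0 a -> og_lt 0 (a *+ n.+1).
Proof.
move=> a0; rewrite /og_lt; apply: contra (a0) => an; apply: og_le_trans an.
by rewrite mulrS -{1}[a]addr0 og_leD2l og_mulrn_ge0 // og_ltW.
Qed.

Lemma og_oppr_gt0 a : og_lt a 0 -> og_lt 0 (- a).
Proof. by rewrite /og_lt -[X in og_le (- _) X]oppr0 og_le_opp. Qed.

Lemma og_mulrz_le a (k l : int) : og_lt a 0 ->
  og_le (a *~ l) (a *~ k) = (k <= l).
Proof.
have anti (p q : int) : og_lt a 0 -> p <= q -> og_le (a *~ q) (a *~ p).
  move=> a0 pq; rewrite -(og_leD2l (- (a *~ q))) addNr -mulrNz -mulrzDr.
  have -> : - q + p = - (`|q - p|%N)%:Z by lia.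
  rewrite mulrNz -mulNrz -[_ *~ _]/(_ *+ _) og_mulrn_ge0 //.
  exact/og_ltW/og_oppr_gt0.
move=> a0; case kl: (k <= l); first exact: anti.
move/negbT: kl; rewrite -ltNge => lk.
apply/negP; rewrite -(og_leD2l (- (a *~ l))) addNr -mulrNz -mulrzDr => H.
have E : - l + k = (`|k - l|%N.-1.+1)%:Z by lia.
have := og_mulrn_gt0 (`|k - l|%N.-1) (og_oppr_gt0 a0).
rewrite /og_lt -[X in og_le _ X]oppr0 mulNrn og_le_opp.
by move: H; rewrite E -[_ *~ _]/(_ *+ _) => ->.
Qed.

Lemma og_mulrz_eq0 a (k : int) : a != 0 -> a *~ k = 0 -> k = 0.
Proof.
have neg c : og_lt c 0 -> c *~ k = 0 -> k = 0.
  move=> c0 E; have := og_mulrz_le k 0 c0; have := og_mulrz_le 0 k c0.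
  rewrite E mulr0z og_le_refl => /esym k0 /esym k1.
  by apply: le_anti; rewrite k0 k1.
move=> a0 E; case La: (og_le 0 a); last first.
  by apply: (neg a) => //; rewrite /og_lt La.
apply: (neg (- a)); last by rewrite mulNrz E oppr0.
rewrite /og_lt -{1}oppr0 og_le_opp; apply: contra a0 => La'.
by apply/eqP/(@og_le_anti G); rewrite La La'.
Qed.
End OptionOrder.

(** * Ultrametric maps *)

Record ultrametric (V : zmodType) (G : orderedGroup) (v : V -> option G) := {
  um0 : v 0 = None;
  umN : forall f, v (- f) = v f;
  umD : forall f g, ole (omin (v f) (v g)) (v (f + g))
}.

Section Ultrametric.
Variables (V : zmodType) (G : orderedGroup) (v : V -> option G).
Hypothesis vU : ultrametric v.

Lemma um_addl x f g : ole x (v f) -> ole x (v g) -> ole x (v (f + g)).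
Proof.
by move=> xf xg; apply: ole_trans (umD vU f g); rewrite ole_omin xf.
Qed.

Lemma um_addlt a f g :
  olt (Some a) (v f) -> olt (Some a) (v g) -> olt (Some a) (v (f + g)).
Proof.
move=> xf xg; apply: olt_le_trans (umD vU f g).
by rewrite /omin; case: ifP.
Qed.

Lemma um_sumlt a (I : finType) (P : pred I) (F : I -> V) :
  (forall i, P i -> olt (Some a) (v (F i))) ->
  olt (Some a) (v (\sum_(i | P i) F i)).
Proof.
by move=> H; elim/big_ind: _ => //; [rewrite (um0 vU)|apply: um_addlt].
Qed.

(** If [v (f + g)] exceeded [v f], so would [v ((f + g) - g)]. *)
Lemma um_strict f g : olt (v f) (v g) -> v (f + g) = v f.
Proof.
move=> fg; apply: ole_anti; apply/andP; split; last first.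
  by apply: um_addl; [apply: ole_refl|apply: oltW].
have := umD vU (f + g) (- g); rewrite addrK (umN vU) {1}/omin.
case: ifP => // _ gf; case/negP: fg; exact: gf.
Qed.

Lemma um_dominant (I : finType) (F : I -> V) i0 a : v (F i0) = Some a ->
  (forall i, i != i0 -> olt (Some a) (v (F i))) -> v (\sum_i F i) = Some a.
Proof.
move=> E H; rewrite (bigD1 i0) //= um_strict // E.
exact: um_sumlt.
Qed.

(** A term of least value is strictly smallest, as no other term can share its
    value. *)
Lemma um_dominantP (I : finType) (F : I -> V) :
    (forall i j, v (F i) = v (F j) -> v (F i) <> None -> i = j) ->
  (forall i, v (F i) = None) \/
  exists i0 a, v (F i0) = Some a /\
    forall i, i != i0 -> olt (Some a) (v (F i)).
Proof.
move=> inj; case: (pickP (fun i => v (F i) != None)) => [j j0|N]; last first.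
  by left=> i; move/eqP: (N i).
right; case: (@extremumP _ _ _ j xpredT (fun i => v (F i))
  (@ole_refl G) (@ole_trans G) (@ole_total G) isT).
move=> i0 _ mini.
case E: (v (F i0)) => [a|]; last first.
  by move: (mini j isT) j0; rewrite E; case: (v (F j)).
exists i0, a; split=> // i ii0; rewrite -E.
case: (ole_eqVlt (mini i isT)) => // eqv.
by case/eqP: ii0; apply/esym/inj => //; rewrite E.
Qed.
End Ultrametric.

(** * From a domain to its field of fractions *)

(** A K-valuation on a K-domain; uniqueness of the residue constant follows
    from [dv_const]. *)
Record dom_Kvaluation (K : fieldType) (R : idomainType)
    (iota : {rmorphism K -> R}) (G : orderedGroup) (v : R -> option G) := {
  dv_oo : forall f, v f = None <-> f = 0;
  dv_mul : forall f g, v (f * g) = oadd (v f) (v g);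
  dv_add : forall f g, ole (omin (v f) (v g)) (v (f + g));
  dv_const : forall c, c != 0 -> v (iota c) = Some 0;
  dv_res : forall f g, v f = v g -> v f <> None ->
    exists c : K, olt (v f) (v (f + iota c * g))
}.

Section Fractions.
Variables (K : fieldType) (R : idomainType) (iota : {rmorphism K -> R}).
Variables (iotaF : {rmorphism K -> {fraction R}}).
Variables (G : orderedGroup) (v : R -> option G).
Hypothesis iotaFE : forall c, iotaF c = (iota c)%:F.
Hypothesis vK : dom_Kvaluation iota v.

Lemma dom_ultrametric : ultrametric v.
Proof.
split; [exact/(dv_oo vK) | | exact: dv_add vK].
move=> f; rewrite -mulN1r (dv_mul vK) -(rmorph1 iota) -rmorphN.
by rewrite (dv_const vK) ?oadd0 // oppr_eq0 oner_eq0.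
Qed.

Lemma dom_frac_mapE f g : g != 0 ->
  frac_map v (f%:F / g%:F) = osub (v f) (v g).
Proof.
apply: frac_mapE; first exact/(dv_oo vK).
  by move=> h; apply: contra_neq => /(dv_oo vK).
by move=> h k a b E1 E2; rewrite (dv_mul vK) E1 E2.
Qed.

Lemma common_denominator (s t : {fraction R}) :
  exists2 d : R, d != 0 & exists f g : R, s = f%:F / d%:F /\ t = g%:F / d%:F.
Proof.
have ds := denom_ratioP (repr s); have dt := denom_ratioP (repr t).
set a := \d_(repr s) in ds; set b := \d_(repr t) in dt.
exists (a * b); first by rewrite mulf_neq0.
exists (\n_(repr s) * b), (\n_(repr t) * a).
rewrite {1}(frac_repr s) {1}(frac_repr t) !tofracM; split.
  by rewrite -mulf_div divff ?mulr1 // tofrac_eq0.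
by rewrite [a%:F * _]mulrC -mulf_div divff ?mulr1 // tofrac_eq0.
Qed.

Lemma dv_some d : d != 0 -> exists a, v d = Some a.
Proof.
move=> d0; case E: (v d) => [a|]; first by exists a.
by move/(dv_oo vK): E d0 => ->; rewrite eqxx.
Qed.

(** All conditions reduce to numerators over a common denominator. If two
    constants [c] and [c'] both raised the value, so would their difference
    [(c - c') g], against [v (c - c') = 0]. *)
Theorem frac_Kvaluation : is_Kvaluation iotaF (frac_map v).
Proof.
have vU := dom_ultrametric.
split.
- move=> s; have [d d0 [f [_ [-> _]]]] := common_denominator s s.
  have [a E] := dv_some d0; rewrite dom_frac_mapE // E osubE.
  have -> : oadd (Some (- a)) (v f) = None <-> v f = None by case: (v f).
  rewrite (dv_oo vK); split=> [->|/eqP]; first by rewrite tofrac0 mul0r.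
  by rewrite mulf_eq0 invr_eq0 !tofrac_eq0 (negPf d0) orbF => /eqP.
- move=> s t; have [d d0 [f [g [-> ->]]]] := common_denominator s t.
  have [a E] := dv_some d0.
  rewrite mulf_div -!tofracM !dom_frac_mapE ?mulf_neq0 // !(dv_mul vK) E.
  case: (v f) (v g) => [b|] [c|] //=.
  by rewrite /oadd /osub opprD addrACA.
- move=> s t; have [d d0 [f [g [-> ->]]]] := common_denominator s t.
  have [a E] := dv_some d0.
  rewrite -mulrDl -tofracD !dom_frac_mapE // E !osubE /omin ole_add2l.
  by have := dv_add vK f g; rewrite /omin; case: ifP => _; rewrite ole_add2l.
move=> s t; have [d d0 [f [g [-> ->]]]] := common_denominator s t.
have [a E] := dv_some d0.
have FE c : f%:F / d%:F + iotaF c * (g%:F / d%:F)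
  = (f + iota c * g)%:F / d%:F :> {fraction R}.
  by rewrite iotaFE mulrA -mulrDl tofracD tofracM.
rewrite !dom_frac_mapE // E !osubE => /oadd_inj fg fN.
have {}fN : v f <> None by move=> N; apply: fN; rewrite N.
have [c Hc] := dv_res vK fg fN.
exists c; split; first by rewrite FE dom_frac_mapE // E osubE olt_add2l.
move=> c'; rewrite FE dom_frac_mapE // E osubE olt_add2l => Hc'.
apply/eqP; apply: contraT => cc'.
case Ef: (v f) fN Hc Hc' => [b|] // _ Hc Hc'.
have := um_addlt vU Hc; move/(_ (- (f + iota c' * g))).
rewrite (umN vU) => /(_ Hc').
rewrite opprD addrACA subrr add0r -mulrBl -rmorphB (dv_mul vK).
by rewrite (dv_const vK) ?subr_eq0 // oadd0 -fg Ef /olt ole_refl.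
Qed.
End Fractions.

(** * The degree valuation *)

Lemma int_leD2r (c a b : int) : a <= b -> a + c <= b + c.
Proof. by rewrite lerD2r. Qed.

Definition ZG : orderedGroup :=
  @OrderedGroup int (fun a b => a <= b) le_anti le_trans le_total int_leD2r.

Section Degree.
Variable K : fieldType.

Definition Kx_const : {rmorphism K -> Kx K} :=
  @FracField.tofrac {poly K} \o @polyC K.

(** For the residue condition, the quotient of the leading coefficients of two
    polynomials of equal degree cancels the leading terms. *)
Lemma degree_Kvaluation : @dom_Kvaluation K {poly K} (@polyC K) ZG
  (fun f => if f == 0 then None else Some (- ((size f).-1)%:Z)).
Proof.
split.
- by move=> f; case: eqP.
- move=> f g; rewrite mulf_eq0.
  case: eqVneq => [//|f0]; case: eqVneq => [//|g0] /=.
  rewrite size_mul // /oadd; congr Some.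
  rewrite -!size_poly_gt0 in f0 g0.
  case: (size f) f0 (size g) g0 => [|p] // _ [|q] // _.
  by rewrite addSn addnS /= PoszD opprD.
- move=> f g; case: (eqVneq f 0) => [->|f0].
    by rewrite add0r omin0l ole_refl.
  case: (eqVneq g 0) => [->|g0].
    by rewrite addr0 omin0r (negPf f0) ole_refl.
  case: eqVneq => [_|fg0]; first by case: omin.
  rewrite -!size_poly_gt0 in f0 g0 fg0.
  rewrite /omin /=.
  have arith (a b c : nat) : (0 < a)%N -> (0 < b)%N -> (0 < c)%N ->
      (c <= maxn a b)%N ->
      (if - a.-1%:Z <= - b.-1%:Z then - a.-1%:Z else - b.-1%:Z) <= - c.-1%:Z.
    by case: ifP; lia.
  by have := arith _ _ _ f0 g0 fg0 (size_polyD f g); case: ifP.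
- by move=> c c0; rewrite polyC_eq0 (negPf c0) size_polyC c0.
move=> f g; case: (eqVneq f 0) => [//|f0]; case: (eqVneq g 0) => [//|g0] [E] _.
exists (- (lead_coef f / lead_coef g)).
have -> : f + (- (lead_coef f / lead_coef g))%:P * g
    = f - (lead_coef f / lead_coef g) *: g.
  by rewrite polyCN mulNr mul_polyC.
set h := f - _.
have {E} E : (size f).-1 = (size g).-1.
  by apply/eqP; rewrite -eqz_nat -eqr_opp; apply/eqP.
rewrite -size_poly_gt0 in f0; have sf := prednK f0.
have sg : (size g).-1.+1 = size g by rewrite prednK // size_poly_gt0.
have hf : (size h <= (size f).-1)%N.
  apply/leq_sizeP => j; rewrite leq_eqVlt => /orP[/eqP<-|fj].
    rewrite coefB coefZ {2}E -[g`__]/(lead_coef g) mulfVK ?lead_coef_eq0 //.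
    by rewrite subrr.
  rewrite coefB coefZ !nth_default ?mulr0 ?subrr //; first by rewrite -sg -E.
  by rewrite -sf.
rewrite /olt; case: eqVneq => [//|h0] /=; rewrite -ltNge ltrN2 ltz_nat.
rewrite -size_poly_gt0 in h0.
by rewrite [X in (X <= _)%N](_ : _ = size h) // prednK.
Qed.

Lemma v_infty_Kvaluation :
  is_Kvaluation Kx_const (@v_infty K : Kx K -> option ZG).
Proof. exact: (frac_Kvaluation _ degree_Kvaluation). Qed.

Lemma v_infty_eq0 (c : Kx K) : v_infty c = None <-> c = 0.
Proof. exact: (Kval_oo v_infty_Kvaluation). Qed.

Lemma v_inftyM (c d : Kx K) k l : v_infty c = Some k -> v_infty d = Some l ->
  v_infty (c * d) = Some (k + l).
Proof.
move=> E1 E2; have := Kval_mul v_infty_Kvaluation c d.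
by rewrite [X in oadd X _]E1 [X in oadd _ X]E2.
Qed.

Lemma v_infty_poly (p : {poly K}) : p != 0 ->
  v_infty (p%:F : Kx K) = Some (- (size p).-1%:Z).
Proof.
move=> p0; rewrite -[p%:F]divr1 -tofrac1 v_inftyE ?oner_eq0 // (negPf p0).
by rewrite size_poly1 sub0r.
Qed.

Lemma v_infty_ultrametric : ultrametric (@v_infty K : Kx K -> option ZG).
Proof.
have vK := v_infty_Kvaluation.
split; [exact/(Kval_oo vK) | | exact: Kval_add vK].
have E1 : v_infty (-1 : Kx K) = Some 0.
  have -> : (-1 : Kx K) = (- 1%:P : {poly K})%:F by rewrite tofracN tofrac1.
  by rewrite v_infty_poly ?oppr_eq0 ?oner_eq0 // size_polyN size_poly1.
by move=> f; have := Kval_mul vK (-1) f; rewrite mulN1r [X in oadd X]E1 oadd0.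
Qed.
End Degree.

(** * The associated map is a K-valuation *)

Lemma zcomb_eq (M : zmodType) (a b : M) (k k' : int) (p p' i i' : nat) :
    a *~ k + a *+ p + b *+ i = a *~ k' + a *+ p' + b *+ i' ->
  a *~ (k + p%:Z - (k' + p'%:Z)) = b *~ (i'%:Z - i%:Z).
Proof.
rewrite !mulrzBr !mulrzDr -!pmulrn => /eqP; rewrite -subr_eq => /eqP <-.
by rewrite opprB addrCA (opprD (a *~ k + a *+ p)) (addrA (_ + _)) subrr sub0r.
Qed.

(** Reducing modulo [m] gives [j = j'], as [n] is invertible modulo [m]. *)
Lemma coprime_digits (m n j j' : nat) (k k' : int) :
    coprime m n -> (j < m)%N -> (j' < m)%N ->
    - k * m%:Z + (j * n)%:Z - (- k' * m%:Z + (j' * n)%:Z) = 0 ->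
  j = j' /\ k = k'.
Proof.
move=> co_mn jm jm' E.
have {}E : (j%:Z - j'%:Z) * n%:Z = (k - k') * m%:Z.
  by apply/eqP; rewrite -subr_eq0 -E !PoszM; apply/eqP; ring.
have jj : j = j'.
  have : (m %| `|(j%:Z - j'%:Z)%R| * n)%N.
    by rewrite -[n in X in (_ %| X)%N]absz_nat -abszM E abszM dvdn_mull.
  rewrite Gauss_dvdl // => /dvdnP[[|q]]; first by lia.
  by nia.
split=> //; move/eqP: E.
by rewrite jj subrr mul0r eq_sym mulf_eq0 subr_eq0 => /orP[/eqP|] //; lia.
Qed.

(** The reduction of [y * c y^j w^i] when [y^(j+1) = w - z]. *)
Lemma carry (R : comNzRingType) (y c z w : R) i j : y * y ^+ j = w - z ->
  y * (c * y ^+ j * w ^+ i)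
    = - (z * c) * y ^+ 0 * w ^+ i + c * y ^+ 0 * w ^+ i.+1.
Proof. by move=> H; rewrite mulrA [y * (c * _)]mulrCA H exprS; ring. Qed.

(** The left-hand side is the value required of [y * c y^j w^i], where
    [A + j n a + B] is the value of [c y^j w^i]; the right-hand side is the
    value of its reduced term in [z], for [j + 1 = m]. *)
Lemma carry_value (M : zmodType) (a A B : M) j n :
  a *+ n + (A + a *+ (j * n) + B) = A + B + a *+ (j.+1 * n).
Proof. by rewrite (addrAC A) mulSn mulrnDr [RHS]addrCA. Qed.

(** The differences with the dominant monomials [c y w] and [d y w] are split
    off, leaving one monomial whose coefficient [c + e d] can be made small. *)
Lemma cancel_split (R : comNzRingType) (f g c d e y w : R) :
  f + e * g = (f - c * y * w) + e * (g - d * y * w) + (c + e * d) * y * w.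
Proof. by ring. Qed.

Section AssociatedMap.
(* Of [z = x^n] only the degree in [x] matters. *)
Variables (K : fieldType) (m n : nat) (z : Kx K) (a b : ZZ).
Let w : Kx_y K := 'X^m + z%:P.
Hypotheses (m_gt0 : (0 < m)%N) (co_mn : coprime m n).
Hypothesis z_val : v_infty z = Some (- n%:Z).
Hypothesis adm : admissible m w a b.
Hypothesis lt_ab : og_lt (a *+ (m * n)) b.

Let v : Kx_y K -> option ZZ := assoc_map m n w a b.
Let term i j (c : Kx K) : option ZZ := w_term m n a b i j c.
Let mono (c : Kx K) (j i : nat) : Kx_y K := c%:P * 'X^j * w ^+ i.
Implicit Types (f g h : Kx_y K) (c d : Kx K) (i j : nat) (x : option ZZ).
Let V : Kx K -> option ZG := @v_infty K.

Let V_ultrametric : ultrametric V.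
Proof. exact: v_infty_ultrametric. Qed.

Let w_monic : w \is monic. Proof. by case: adm. Qed.
Let size_w : size w = m.+1. Proof. by case: adm. Qed.
Let a_lt0 : og_lt a (0 : ZZ). Proof. by case: adm. Qed.

Lemma termE i j c k : v_infty c = Some k ->
  term i j c = Some (a *~ (- k * m%:Z) + a *+ (j * n) + b *+ i).
Proof. by rewrite /term /w_term => ->. Qed.

Lemma term_eq0 i j c : term i j c = None <-> c = 0.
Proof. by rewrite -v_infty_eq0 /term /w_term; case: v_infty. Qed.

Lemma term0 i j : term i j 0 = None.
Proof. exact/term_eq0. Qed.

Lemma ole_term i j c d : ole (term i j c) (term i j d) = ole (V c) (V d).
Proof.
rewrite /V; case Ec: (v_infty c) => [k|]; last first.
  have /term_eq0 -> : c = 0 by apply/v_infty_eq0.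
  case Ed: (v_infty d) => [l|]; first by rewrite (termE _ _ Ed).
  by have /term_eq0 -> : d = 0 by apply/v_infty_eq0.
rewrite (termE _ _ Ec); case Ed: (v_infty d) => [l|]; last first.
  by have /term_eq0 -> : d = 0 by apply/v_infty_eq0.
rewrite (termE _ _ Ed) !ole_Some -!addrA ![a *~ _ + _]addrC og_leD2l.
rewrite og_mulrz_le // !mulNr lerN2.
by rewrite ler_pM2r.
Qed.

Lemma olt_term i j c d : olt (V c) (V d) -> olt (term i j c) (term i j d).
Proof. by rewrite /olt ole_term. Qed.

(** For [c != 0] the value of [c y^j w^i] determines [i] and the coefficient
    [deg c * m + j * n] of alpha, because alpha and beta are not commensurable;
    the latter determines [j < m], and then [deg c], because [n] is invertible
    modulo [m]. *)
Lemma term_inj i i' j j' c c' : (j < m)%N -> (j' < m)%N ->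
    term i j c = term i' j' c' -> term i j c <> None ->
  [/\ i = i', j = j' & V c = V c'].
Proof.
move=> jm jm'; rewrite /V; case Ec: (v_infty c) => [k|]; last first.
  by have /term_eq0 -> : c = 0 by apply/v_infty_eq0.
rewrite (termE _ _ Ec); case Ec': (v_infty c') => [k'|]; last first.
  by have /term_eq0 -> : c' = 0 by apply/v_infty_eq0.
rewrite (termE _ _ Ec') => /Some_inj E _.
have [_ _ _ b0 [_ _ ncom]] := adm.
have {}E := zcomb_eq E.
set k1 := (X in a *~ X) in E; set i1 := (X in b *~ X) in E.
have a0 : a != 0.
  by apply: contraL a_lt0 => /eqP ->; rewrite /og_lt og_le_refl.
have k10 : k1 = 0.
  apply/eqP; apply: contraT => k1n; case: ncom; exists k1, i1; split=> //.
  apply: contra_neq k1n => i10; apply: (og_mulrz_eq0 a0).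
  by rewrite E i10 mulr0z.
have i10 : i1 = 0 by apply: (og_mulrz_eq0 b0); rewrite -E k10 mulr0z.
have [jj kk] := coprime_digits co_mn jm jm' k10.
by rewrite jj kk; split=> //; lia.
Qed.

Lemma w_coef_mono c i j i' j' : (j < m)%N -> (j' < m)%N ->
  w_coef w (mono c j i) i' j' = if (i' == i) && (j' == j) then c else 0.
Proof.
move=> jm jm'.
rewrite (@w_expansion_unique _ m w m_gt0 w_monic size_w _ i
  (fun i' j' => if (i' == i) && (j' == j) then c else 0)) //.
  case: eqP => [->|_]; first by rewrite leqnn.
  by rewrite if_same.
rewrite /is_w_expansion (bigD1 (@Ordinal i.+1 i (ltnSn i))) //= eqxx.
rewrite (bigD1 (Ordinal jm)) //= eqxx big1 => [|k].
  rewrite addr0 big1 ?addr0 // => k; rewrite -val_eqE /= => /negPf ->.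
  by apply: big1 => l _; rewrite polyC0 !mul0r.
by rewrite -val_eqE /= => /negPf ->; rewrite polyC0 !mul0r.
Qed.

Lemma w_coef_big f i j :
  (size (f : {poly Kx K}) < i)%N -> (j < m)%N -> w_coef w f i j = 0.
Proof.
move=> fi jm.
have fE := w_coefP m_gt0 w_monic size_w f.
by rewrite (w_expansion_unique m_gt0 w_monic size_w fE) // leqNgt fi.
Qed.

(** Lower bounds of [v f] are tested on all coefficients at once, without
    reference to the length of the expansion. *)
Lemma ole_assoc x f : ole x (v f) <->
  forall i j, (j < m)%N -> ole x (term i j (w_coef w f i j)).
Proof.
pose T i j := term i j (w_coef w f i j).
rewrite /v /assoc_map /w_min.
rewrite (bigmin_ord x (size f).+1 (fun i => \big[@omin ZZ/None]_(j < m) T i j)).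
split=> H i => [j jm|iN].
  case: (ltnP (size f) i) => [fi|fi].
    by rewrite w_coef_big // term0; case: x H.
  by have /(bigmin_ord _ _ (T i)) := H i fi; apply.
by apply/(bigmin_ord _ _ (T i)) => j jm; apply: H.
Qed.

Lemma assoc_mono c i j : (j < m)%N -> v (mono c j i) = term i j c.
Proof.
move=> jm; apply: ole_inj => x; apply/idP/idP.
  by move/ole_assoc => /(_ i j jm); rewrite w_coef_mono // !eqxx.
move=> H; apply/ole_assoc => i' j' jm'; rewrite w_coef_mono //.
case: ifP => [/andP[/eqP -> /eqP ->] //|_].
by rewrite term0; case: x {H}.
Qed.

Lemma w_coefD f g i j : w_coef w (f + g) i j = w_coef w f i j + w_coef w g i j.
Proof. by rewrite /w_coef divpD modpD coefD. Qed.

Lemma w_coefN f i j : w_coef w (- f) i j = - w_coef w f i j.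
Proof. by rewrite /w_coef divpN modpN coefN. Qed.

Lemma assoc_ultrametric : ultrametric v.
Proof.
split.
- have /(ole_anti (G := ZZ)) // : ole None (v 0) && ole (v 0) None.
  rewrite andbC; case: (v 0) (ole_assoc None 0) => //= g [_ H].
  apply: H => i j _.
  by rewrite /w_coef div0p mod0p coef0 term0.
- move=> f; apply: ole_inj => x; apply/idP/idP => /ole_assoc H; apply/ole_assoc.
    move=> i j jm; apply: ole_trans (H i j jm) _.
    by rewrite w_coefN ole_term (umN V_ultrametric) ole_refl.
  move=> i j jm; apply: ole_trans (H i j jm) _.
  by rewrite w_coefN ole_term (umN V_ultrametric) ole_refl.
move=> f g; apply/ole_assoc => i j jm.
have := ole_refl (omin (v f) (v g)); rewrite ole_omin.
set x := omin _ _ => /andP[/ole_assoc/(_ i j jm) xf /ole_assoc/(_ i j jm) xg].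
have := umD V_ultrametric (w_coef w f i j) (w_coef w g i j).
rewrite -w_coefD {1}/omin; case: ifP => _; rewrite -(ole_term i j).
  exact: ole_trans.
exact: ole_trans.
Qed.

Lemma assoc_eq0 f : v f = None <-> f = 0.
Proof.
split=> [E|->]; last exact: (um0 assoc_ultrametric).
rewrite (w_coefP m_gt0 w_monic size_w f).
apply: big1 => i _; apply: big1 => j _.
have /ole_assoc/(_ i j (ltn_ord j)) : ole None (v f) by rewrite E.
case Et: (term _ _ _) => // _; move/term_eq0: Et => ->.
by rewrite polyC0 !mul0r.
Qed.

(** One monomial of the expansion dominates, because distinct nonzero monomials
    have distinct values. *)
Lemma expansion_dominant f : f != 0 ->
  exists (F : 'I_(size f).+1 * 'I_m -> Kx_y K) p0 (g : ZZ),
  [/\ f = \sum_p F p,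
      forall p, F p = mono (w_coef w f p.1 p.2) p.2 p.1,
      v (F p0) = Some g &
      forall p, p != p0 -> olt (Some g) (v (F p))].
Proof.
move=> f0.
pose F (p : 'I_(size f).+1 * 'I_m) := mono (w_coef w f p.1 p.2) p.2 p.1.
have fE : f = \sum_p F p.
  rewrite {1}(w_coefP m_gt0 w_monic size_w f).
  exact: (pair_bigA _ (fun (i : 'I_(size f).+1) (j : 'I_m) =>
    mono (w_coef w f i j) j i)).
have inj p q : v (F p) = v (F q) -> v (F p) <> None -> p = q.
  rewrite !assoc_mono // => /(term_inj (ltn_ord _) (ltn_ord _)) H /H[i1 j1 _].
  by case: p q i1 j1 {H} => [i j] [i' j'] /= /ord_inj -> /ord_inj ->.
case: (um_dominantP inj) => [N|[p0 [g [Hg H]]]]; last by exists F, p0, g.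
case/eqP: f0; rewrite fE; apply: big1 => p _; exact/assoc_eq0.
Qed.

(** Multiplicativity at a fixed factor [s]. Being stable under products of
    factors, it extends from K(x), [y] and [w] to monomials. *)
Definition multiplier (s : Kx_y K) (sigma : ZZ) : Prop :=
  forall f, v (s * f) = oadd (Some sigma) (v f).

(** Multiplying a sum with a strictly smallest term by [s] shifts all terms
    equally, so the same term stays dominant. *)
Lemma multiplier_mono s sigma :
    (forall c j i, (j < m)%N ->
       v (s * mono c j i) = oadd (Some sigma) (v (mono c j i))) ->
  multiplier s sigma.
Proof.
move=> H f; case: (eqVneq f 0) => [->|f0].
  by rewrite mulr0 (um0 assoc_ultrametric).
have [F [p0 [g [fE FE Eg lt]]]] := expansion_dominant f0.
have sF p : v (s * F p) = oadd (Some sigma) (v (F p)) by rewrite FE H.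
rewrite fE mulr_sumr (um_dominant assoc_ultrametric Eg lt) /=.
apply: (um_dominant assoc_ultrametric (i0 := p0)); first by rewrite sF Eg.
move=> p pp0; rewrite sF -[Some (_ + _)]/(oadd (Some sigma) (Some g)).
by rewrite olt_add2l lt.
Qed.

Lemma multiplierM s t sigma tau :
  multiplier s sigma -> multiplier t tau -> multiplier (s * t) (sigma + tau).
Proof. by move=> Hs Ht f; rewrite -mulrA Hs Ht oaddA. Qed.

Lemma multiplier1 : multiplier 1 0.
Proof. by move=> f; rewrite mul1r oadd0. Qed.

Lemma multiplierX s sigma k :
  multiplier s sigma -> multiplier (s ^+ k) (sigma *+ k).
Proof.
move=> Hs; elim: k => [|k IH]; first exact: multiplier1.
by rewrite exprS mulrS; apply: multiplierM.
Qed.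

Lemma multiplier_const c k : v_infty c = Some k ->
  multiplier c%:P (a *~ (- k * m%:Z)).
Proof.
move=> E; apply: multiplier_mono => d j i jm.
have -> : c%:P * mono d j i = mono (c * d) j i by rewrite /mono polyCM -!mulrA.
apply: etrans (assoc_mono (c * d) i jm) _; rewrite (assoc_mono d i jm).
case Ed: (v_infty d) => [l|]; last first.
  have -> : d = 0 by apply/v_infty_eq0.
  by rewrite mulr0 !term0.
apply: etrans (termE _ _ (v_inftyM E Ed)) _; rewrite (termE _ _ Ed) /oadd.
by rewrite opprD mulrDl mulrzDr !addrA.
Qed.

Lemma multiplier_w : multiplier w b.
Proof.
apply: multiplier_mono => c j i jm.
have -> : w * mono c j i = mono c j i.+1 by rewrite /mono exprS mulrCA.
rewrite !assoc_mono //.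
case Ed: (v_infty c) => [l|]; last first.
  have -> : c = 0 by apply/v_infty_eq0.
  by rewrite !term0.
rewrite !(termE _ _ Ed) /oadd mulrS; congr Some.
by rewrite [RHS]addrCA.
Qed.

(** If [j + 1 = m], then [y * y^j = w - z], where [z] has a smaller value than
    [w], so that the product is dominated by the term in [z]. *)
Lemma multiplier_y : multiplier 'X (a *+ n).
Proof.
apply: multiplier_mono => c j i jm.
rewrite (assoc_mono _ _ jm).
case Ec: (v_infty c) => [k|]; last first.
  have -> : c = 0 by apply/v_infty_eq0.
  rewrite /mono polyC0 !mul0r mulr0 (um0 assoc_ultrametric).
  by rewrite !term0.
rewrite (termE _ _ Ec) [RHS]/oadd.
case: (ltnP j.+1 m) => jm1.
  have -> : 'X * mono c j i = mono c j.+1 i.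
    by rewrite /mono mulrA; congr (_ * _); rewrite exprS mulrCA.
  rewrite assoc_mono // (termE _ _ Ec); congr Some.
  by rewrite !addrA [a *+ n + _]addrC mulSn mulrnDr !addrA.
have {jm1} jE : m = j.+1 by apply/eqP; rewrite eqn_leq jm jm1.
have -> : 'X * mono c j i = mono (- (z * c)) 0 i + mono c 0 i.+1.
  by rewrite /mono polyCN polyCM; apply: carry; rewrite -exprS -jE addrK.
have Ez : v_infty (- (z * c)) = Some (- n%:Z + k).
  have := umN V_ultrametric (z * c); rewrite /V => ->.
  exact: v_inftyM.
rewrite carry_value -jE.
set A := a *~ _; set B := b *+ i.
have E1 : v (mono (- (z * c)) 0 i) = Some (A + B + a *+ (m * n)).
  rewrite assoc_mono // (termE _ _ Ez) mul0n mulr0n addr0; congr Some.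
  rewrite [RHS]addrAC; congr (_ + _).
  by rewrite pmulrn -mulrzDr; congr (_ *~ _); rewrite PoszM; ring.
rewrite (um_strict assoc_ultrametric) E1 // assoc_mono // (termE _ _ Ec).
by rewrite /olt ole_Some mul0n mulr0n addr0 mulrSr addrA og_leD2l.
Qed.

Lemma multiplier_monomial c j i k : v_infty c = Some k ->
  multiplier (mono c j i) (a *~ (- k * m%:Z) + a *+ n *+ j + b *+ i).
Proof.
move=> E; apply: multiplierM; last exact/multiplierX/multiplier_w.
by apply: multiplierM; [exact: multiplier_const|exact/multiplierX/multiplier_y].
Qed.

Definition Kx_y_const : {rmorphism K -> Kx_y K} :=
  @polyC (Kx K) \o @FracField.tofrac {poly K} \o @polyC K.

Lemma assoc_const (e : K) : e != 0 -> v (Kx_y_const e) = Some 0.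
Proof.
move=> e0; have -> : Kx_y_const e = mono (e%:P)%:F 0 0.
  by rewrite /mono !mulr1.
have Ee : v_infty (e%:P%:F : Kx K) = Some 0.
  by rewrite v_infty_poly ?polyC_eq0 // size_polyC e0.
rewrite assoc_mono // (termE _ _ Ee).
by rewrite oppr0 mul0r mulr0z mul0n mulr0n !addr0.
Qed.

(** Nonzero monomials are multipliers, hence, multiplication being
    commutative, so is every nonzero element. *)
Lemma assocM f g : v (f * g) = oadd (v f) (v g).
Proof.
case E: (v f) => [s|]; last first.
  by move/assoc_eq0: E => ->; rewrite mul0r (um0 assoc_ultrametric).
(* It suffices to evaluate [mono * f], where [mono] is a multiplier. *)
have : multiplier f s; last exact.
apply: multiplier_mono => c j i jm; rewrite mulrC.
case Ec: (v_infty c) => [k|]; last first.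
  have -> : c = 0 by apply/v_infty_eq0.
  by rewrite /mono polyC0 !mul0r (um0 assoc_ultrametric).
have H := multiplier_monomial j i Ec.
have := H 1; have := H f; rewrite E mulr1 => -> ->.
rewrite -(rmorph1 Kx_y_const) (assoc_const (oner_neq0 K)).
by rewrite /oadd addr0 [in RHS]addrC.
Qed.

(** Removing the dominant monomial leaves only terms of larger value. *)
Lemma leading_monomial f : f != 0 -> exists c j i (g : ZZ),
  [/\ (j < m)%N, v f = Some g, term i j c = Some g &
      olt (Some g) (v (f - mono c j i))].
Proof.
move=> f0; have [F [p0 [g [fE FE Eg lt]]]] := expansion_dominant f0.
exists (w_coef w f p0.1 p0.2), p0.2, p0.1, g; split=> //.
- by rewrite fE; apply: (um_dominant assoc_ultrametric Eg lt).
- by rewrite -assoc_mono // -FE.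
rewrite -FE fE (bigD1 p0) //= addrAC subrr add0r.
exact: (um_sumlt assoc_ultrametric).
Qed.

(** Elements of equal value have dominant monomials of the same degree, and a
    constant multiple of one cancels the leading coefficient of the other. *)
Lemma assoc_Kvaluation : dom_Kvaluation Kx_y_const v.
Proof.
have vU := assoc_ultrametric.
split; [exact: assoc_eq0|exact: assocM|exact: umD vU|exact: assoc_const|].
move=> f g fg fN.
have f0 : f != 0 by apply: contra_notN fN => /eqP ->; exact: (um0 vU).
have g0 : g != 0.
  by apply: contra_notN fN => /eqP g0; rewrite fg g0; exact: (um0 vU).
have [c [j [i [s [jm Ef Ec Lf]]]]] := leading_monomial f0.
have [d [j' [i' [t [jm' Eg Ed Lg]]]]] := leading_monomial g0.
have [ts] : Some t = Some s :> option ZZ by rewrite -Eg -Ef.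
rewrite {t}ts in Eg Ed Lg.
have [ii jj Vcd] : [/\ i = i', j = j' & V c = V d].
  by apply: term_inj => //; rewrite Ec.
rewrite -ii -jj in Ed Lg.
have Vc : V c <> None by move/v_infty_eq0 => c0; move: Ec; rewrite c0 term0.
have [e [He _]] := Kval_res (v_infty_Kvaluation K) Vcd Vc.
exists e; rewrite Ef.
have -> : f + Kx_y_const e * g = (f - mono c j i)
    + Kx_y_const e * (g - mono d j i) + mono (c + Kx_const K e * d) j i.
  rewrite /mono polyCD polyCM.
  exact: (cancel_split f g c%:P d%:P (Kx_const K e)%:P).
(* [e] was chosen to raise the value of [c + e d] above that of [c]. *)
apply: (um_addlt vU); last first.
  by rewrite assoc_mono // -Ec; apply: olt_term.
apply: (um_addlt vU) => //.
case: (eqVneq e 0) => [->|e0]; first by rewrite rmorph0 mul0r (um0 vU).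
by rewrite assocM assoc_const // oadd0.
Qed.
End AssociatedMap.

(** * Values of polynomials *)

(** Division by a monic polynomial stays inside the coefficient ring. *)
Lemma base_expansion (R : comNzRingType) m (w : {poly R}) :
    (0 < m)%N -> w \is monic -> size w = m.+1 ->
  forall N (q : {poly R}), (size q <= N)%N ->
  exists2 d : nat -> {poly R}, (forall i, (size (d i) <= m)%N) &
    q = \sum_(i < N.+1) d i * w ^+ i.
Proof.
move=> m0 wM wS; elim=> [|N IH] q qN.
  move: qN; rewrite leqn0 size_poly_eq0 => /eqP ->.
  exists (fun=> 0) => [i|]; first by rewrite size_poly0.
  by rewrite big1 // => i _; rewrite mul0r.
set q' := Pdiv.Ring.rdivp q w; set r := Pdiv.Ring.rmodp q w.
have qE : q = q' * w + r by apply: Pdiv.RingMonic.rdivp_eq.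
have rS : (size r <= m)%N.
  by rewrite -ltnS -wS Pdiv.CommonRing.ltn_rmodpN0 // monic_neq0.
have qS : (size q' <= N)%N.
  have [->|q0] := eqVneq q' 0; first by rewrite size_poly0.
  have E : size (q' * w) = (size q' + m)%N by rewrite size_Mmonic // wS addnS.
  have q'0 : (0 < size q')%N by rewrite size_poly_gt0.
  have E2 : size q = (size q' + m)%N.
    rewrite qE size_polyDl E // (leq_ltn_trans rS) //.
    by rewrite -[X in (X < _)%N]add0n ltn_add2r.
  by move: qN; rewrite E2; lia.
have [d dS dE] := IH _ qS.
exists (fun i => if i is k.+1 then d k else r) => [[|i] //|].
rewrite big_ord_recl expr0 mulr1 addrC {1}qE dE mulr_suml; congr (_ + _).
by apply: eq_bigr => i _; rewrite /= exprSr mulrA.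
Qed.

Section Polynomials.
Variables (K : fieldType).

Definition frac_coef : {rmorphism {poly {poly K}} -> Kx_y K} :=
  map_poly (@FracField.tofrac {poly K}).

Lemma mpoly_frac_coef (f : {mpoly K[2]}) :
  exists q, Kxy_of_mpoly f = (frac_coef q)%:F.
Proof.
pose psi : {rmorphism {poly {poly K}} -> Kxy K} :=
  @FracField.tofrac (Kx_y K) \o frac_coef.
rewrite /Kxy_of_mpoly /mmap.
exists (\sum_(e <- msupp f) (f@_e)%:P%:P *
  \prod_(i < 2) (if i == 0 then 'X%:P else 'X) ^+ e i).
rewrite -[RHS]/(psi _) rmorph_sum; apply: eq_bigr => e _.
rewrite rmorphM; congr (_ * _).
  by rewrite /= /frac_coef map_polyC.
rewrite rmorph_prod; apply: eq_bigr => i _; rewrite rmorphXn; congr (_ ^+ _).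
by case: (i == 0); rewrite /= /frac_coef ?map_polyC ?map_polyX.
Qed.

(** The coefficients of the expansion are polynomials [p] in [x], with
    [- v_infty p = deg p >= 0], so all terms lie in the cone. *)
Lemma cone_assoc m n (a b : ZZ) (w : {poly {poly K}}) (q : {poly {poly K}}) g :
    (0 < m)%N -> w \is monic -> size w = m.+1 ->
  assoc_map m n (frac_coef w) a b (frac_coef q) = Some g -> cone a b g.
Proof.
move=> m0 wM wS.
have [d dS qE] := base_expansion m0 wM wS (leqnn (size q)).
have wM' : frac_coef w \is monic by apply: monic_map.
have wS' : size (frac_coef w : {poly Kx K}) = m.+1.
  rewrite /frac_coef /= size_map_inj_poly ?wS ?tofrac0 // => x y /eqP.
  by rewrite tofrac_eq => /eqP.
have H : is_w_expansion m (frac_coef w) (frac_coef q) (size q)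
    (fun i j => ((d i)`_j)%:F).
  rewrite /is_w_expansion {1}qE rmorph_sum; apply: eq_bigr => i _.
  rewrite rmorphM rmorphXn -mulr_suml; congr (_ * _).
  apply/polyP => j; rewrite /frac_coef coef_map /=.
  under eq_bigr do rewrite mul_polyC.
  rewrite -(poly_def m (fun j => ((d i)`_j)%:F)) coef_poly.
  case: ltnP => // mj; rewrite nth_default ?tofrac0 //.
  exact: leq_trans (dS i) mj.
rewrite (assoc_mapE _ _ _ m0 wM' wS' H) /w_min.
pose Q (x : option ZZ) := if x is Some g then cone a b g else True.
have Qmin x y : Q x -> Q y -> Q (omin x y) by apply: omin_or.
set W := \big[_/_]_(_ < _) _.
suff : Q W by move=> C E; rewrite /Q E in C.
apply: (big_ind Q) => // i _; apply: (big_ind Q) => //.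
move=> j _; rewrite /w_term.
have [->|p0] := eqVneq ((d i)`_j) 0; first by rewrite tofrac0 v_infty0.
rewrite v_infty_poly //= opprK; set k := (size _).-1.
exists (k * m + j * n)%N, i; rewrite mulrnDr; congr (_ + _ + _).
Qed.
End Polynomials.

(** * Well-ordering *)

Lemma nat_least (P : nat -> Prop) : (exists k, P k) ->
  exists2 k, P k & forall l, P l -> (k <= l)%N.
Proof.
move=> [k]; elim/ltn_ind: k => k IH Pk.
have [[l [lk Pl]]|N] := classic (exists l, (l < k)%N /\ P l).
  exact: IH Pl.
exists k => // l Pl; rewrite leqNgt; apply/negP => lk; apply: N; by exists l.
Qed.

(** The largest element minimises the absolute value of the first coordinate,
    and then that of the second. *)
Lemma nonpos_reversely_well_ordered (P : ZZ -> Prop) :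
  (forall g, P g -> nonpos_quadrant g) -> reversely_well_ordered P.
Proof.
move=> PQ S SP [g0 Sg0].
have absE (x : int) : x <= 0 -> x = - `|x|%N%:Z by lia.
have [k [g1 [Sg1 g1E]] kmin] :
    exists2 k, (exists g : ZZ, S g /\ g.1 = - k%:Z) &
      forall l, (exists g : ZZ, S g /\ g.1 = - l%:Z) -> (k <= l)%N.
  apply: nat_least; exists `|g0.1|%N, g0; split=> //.
  by apply: absE; case: (PQ _ (SP _ Sg0)).
have [l [g [Sg [gE1 gE2]]] lmin] :
    exists2 l, (exists g : ZZ, S g /\ g.1 = - k%:Z /\ g.2 = - l%:Z) &
      forall l', (exists g : ZZ, S g /\ g.1 = - k%:Z /\ g.2 = - l'%:Z) ->
      (l <= l')%N.
  apply: nat_least; exists `|g1.2|%N, g1; split=> //; split=> //.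
  by apply: absE; case: (PQ _ (SP _ Sg1)).
exists g => // h Sh; have [h1 h2] := PQ _ (SP _ Sh).
have kh : (k <= `|h.1|)%N by apply: kmin; exists h; split=> //; apply: absE.
rewrite -[og_le h g]/(lexZZ h g) lexZZ_leE gE1 gE2.
case: (ltrP h.1 (- k%:Z)) => //= kh1.
have hk : h.1 = - k%:Z.
  by apply: le_anti; rewrite kh1 [X in X <= _]absE // lerN2 lez_nat kh.
have lh : (l <= `|h.2|)%N.
  by apply: lmin; exists h; split=> //; split=> //; apply: absE.
by rewrite hk eqxx /= [X in X <= _]absE // lerN2 lez_nat lh.
Qed.

(** * Comparison with monomial orders *)

(** The automorphism is onto, and the preimage of [x] has the value
    [- (1, 0)]. *)
Lemma monomial_order_value (K : fieldType) (v : Kxy K -> option ZZ) :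
    comes_from_monomial_order
      (fun f : {mpoly K[2]} => omap rV_of_ZZ (v (Kxy_of_mpoly f))) ->
  value_set v (-1, 0).
Proof.
move=> [phi [psi phiK psiK] [le _ H]].
pose f : {mpoly K[2]} := psi 'X_(0 : 'I_2).
have phif : phi f = 'X_(0 : 'I_2) by apply: psiK.
have f0 : f != 0.
  apply/eqP => f0; have := phif; rewrite f0 rmorph0.
  by move=> /(congr1 (fun h : {mpoly K[2]} => msupp h)); rewrite msupp0 msuppX.
have [p [] pS _ E] := H f f0; exists f => //.
move: pS E; rewrite phif msuppX inE => /eqP ->.
case: (v _) => [g|] //= [/rowP E]; congr Some.
have := E 0; have := E 1; rewrite !mxE /= !mnm1E /= => E1 E0.
by case: g {E} E0 E1 => x y /= -> ->.
Qed.

Theorem mainTheorem3 (K : fieldType) (m n : nat)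
    (m_gt0 : (0 < m)%N) (n_gt0 : (0 < n)%N) (co_mn : coprime m n) :
  let w : Kx_y K := 'X^m + ('X^n : {poly K})%:F%:P in
  let alpha : ZZ := (-1, -1) in
  let beta : ZZ := (0, -1) in
  let v0 : Kx_y K -> option ZZ := assoc_map m n w alpha beta in
  let v : Kxy K -> option ZZ := assoc_map_frac m n w alpha beta in
  (forall f g : Kx_y K, g != 0 -> v (f%:F / g%:F) = osub (v0 f) (v0 g)) /\
  is_Kvaluation (@Kxy_const K) v /\
  (forall g, value_set v g -> cone alpha beta g) /\
  (forall g, cone alpha beta g -> nonpos_quadrant g) /\
  reversely_well_ordered (value_set v) /\
  ~ cone alpha beta (-1, 0) /\
  ~ (forall g, value_set v g <-> nonpos_quadrant g) /\
  ~ comes_from_monomial_order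
      (fun f : {mpoly K[2]} => omap rV_of_ZZ (v (Kxy_of_mpoly f))).
Proof.
move=> w alpha beta v0 v.
have z_val : v_infty (('X^n : {poly K})%:F : Kx K) = Some (- n%:Z).
  by rewrite v_infty_poly ?monic_neq0 ?monicXn // size_polyXn.
have lt_ab : og_lt (alpha *+ (m * n)) beta.
  rewrite /og_lt -[og_le _ _]/(lexZZ beta (alpha *+ (m * n))) lexZZ_leE.
  have -> : (alpha *+ (m * n)).1 = - (m * n)%:Z.
    by rewrite (raddfMn fst) /= mulNrn natz.
  have : (0 < m * n)%N by rewrite muln_gt0 m_gt0.
  by rewrite /=; lia.
have vK : dom_Kvaluation (Kx_y_const K) v0.
  exact: (assoc_Kvaluation m_gt0 co_mn z_val (admissible_ex K n m_gt0) lt_ab).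
have vE : forall f g, g != 0 -> v (f%:F / g%:F) = osub (v0 f) (v0 g).
  by move=> f g g0; apply: (dom_frac_mapE vK).
have coneE i j : alpha *+ i + beta *+ j = (- i%:Z, - i%:Z - j%:Z) :> ZZ.
  set g := LHS.
  have g1 : g.1 = - i%:Z.
    by rewrite (raddfD fst) /= !(raddfMn fst) /= mulNrn natz mul0rn addr0.
  have g2 : g.2 = - i%:Z - j%:Z.
    by rewrite (raddfD snd) /= !(raddfMn snd) /= !mulNrn !natz.
  by move: g1 g2; case: g => x y /= -> ->.
have quadrant g : cone alpha beta g -> nonpos_quadrant g.
  by move=> [i [j ->]]; rewrite coneE; split=> /=; lia.
have not_cone : ~ cone alpha beta (-1, 0).
  by move=> [i [j]]; rewrite coneE => -[]; lia.
have values g : value_set v g -> cone alpha beta g.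
  move=> [f _]; have [q ->] := mpoly_frac_coef f.
  have -> : (frac_coef K q)%:F = (frac_coef K q)%:F / 1%:F :> Kxy K.
    by rewrite tofrac1 divr1.
  have one : v0 1 = Some 0.
    by rewrite -(rmorph1 (Kx_y_const K)) (dv_const vK) ?oner_eq0.
  rewrite vE ?oner_eq0 // one.
  case Eq: (v0 (frac_coef K q)) => [h|] //; rewrite /osub subr0 => -[<-].
  pose W : {poly {poly K}} := 'X^m + ('X^n)%:P.
  have sW : (size (('X^n : {poly K})%:P) < size ('X^m : {poly {poly K}}))%N.
    by rewrite size_polyXn ltnS (leq_trans (size_polyC_leq1 _)).
  have WE : w = frac_coef K W.
    by rewrite /frac_coef /= rmorphD rmorphXn /= map_polyX map_polyC.
  apply: (@cone_assoc K m n _ _ W q) => //; last by rewrite -WE.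
    by rewrite monicE lead_coefDl // lead_coefXn.
  by rewrite size_polyDl // size_polyXn.
split=> //; split; first exact: (frac_Kvaluation _ vK).
do 2!split=> //.
split; first by apply: nonpos_reversely_well_ordered => g /values/quadrant.
split=> //; split=> [E|/monomial_order_value/values //].
by apply/not_cone/values/E; split.
Qed.
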